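(* (1) Let $(S*1)$ hold. Then for all $\Gamma'\subseteq\Sigma'\subseteq\Pi_{X'}$ and $\Gamma''\subseteq\Sigma''\subseteq\Pi_{X''}$: $\Gamma'\times\Gamma''\subseteq\Sigma'\times\Sigma''$ is small iff $\Gamma'\subseteq\Sigma'$ is small or $\Gamma''\subseteq\Sigma''$ is small. (2) If the filters are principal filters generated by $\mu$, i.e. for each $A$ there is $\mu(A)\subseteq A$ such that $B\subseteq A$ is big iff $\mu(A)\subseteq B\subseteq A$, then $(S*i)$ is equivalent to $(\mu*i)$ for $i=1,2,3$. (3) Let the notion of size (given by principal filters generated by $\mu$) satisfy $(Opt)$, $(iM)$ and $(<\omega*s)$. Then $(\mu*1)$ and $(s*s)$ are equivalent.
   Context: Let $X=X'\cup X''$ be a disjoint union of index sets, with a set $X_i$ given for each $i\in X$; for $Y\subseteq X$ let $\Pi_Y=\prod_{i\in Y}X_i$, and identify $\Pi_X$ with $\Pi_{X'}\times\Pi_{X''}$. For $\Sigma\subseteq\Pi_X$ and $Y\subseteq X$, $\Sigma\restriction Y=\{\sigma\restriction Y:\sigma\in\Sigma\}$. For each subset $C$ of $\Pi_{X'}$, $\Pi_{X''}$ or $\Pi_X$ a notion of ''big'' subset of $C$ is given such that: $C\subseteq C$ is big, and if $A\subseteq B\subseteq C$ and $A\subseteq C$ is big, then $B\subseteq C$ is big. $A\subseteq C$ is small iff $C\setminus A\subseteq C$ is big. Conditions (universally quantified over $\Sigma'\subseteq\Pi_{X'}$, $\Sigma''\subseteq\Pi_{X''}$, $\Sigma\subseteq\Pi_X$,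 where $\Sigma$ need not be a product; in $(S*2)$ and $(\mu*2)$ the roles of $X'$ and $X''$ are interchangeable, so $Y$ is either of $X',X''$): $(S*1)$ $\Delta\subseteq\Sigma'\times\Sigma''$ is big iff there are big $\Gamma'\subseteq\Sigma'$ and big $\Gamma''\subseteq\Sigma''$ with $\Gamma'\times\Gamma''\subseteq\Delta$. $(S*2)$ $\Gamma\subseteq\Sigma$ big $\Rightarrow$ $\Gamma\restriction Y\subseteq\Sigma\restriction Y$ big. $(S*3)$ $A\subseteq\Sigma$ big $\Rightarrow$ there is a big $B\subseteq\Pi_{X'}\times(\Sigma\restriction X'')$ with $B\restriction X''\subseteq A\restriction X''$. $(\mu*1)$ $\mu(\Sigma'\times\Sigma'')=\mu(\Sigma')\times\mu(\Sigma'')$. $(\mu*2)$ $\mu(\Sigma)\subseteq\Gamma$ $\Rightarrow$ $\mu(\Sigma\restriction Y)\subseteq\Gamma\restriction Y$. $(\mu*3)$ $\mu(\Pi_{X'}\times(\Sigma\restriction X''))\restriction X''\subseteq\mu(\Sigma)\restriction X''$. $(s*s)$ For $\Gamma'\subseteq\Sigma'$, $\Gamma''\subseteq\Sigma''$: $\Gamma'\times\Gamma''\subseteq\Sigma'\times\Sigma''$ is small iff $\Gamma'\subseteq\Sigma'$ is small or $\Gamma''\subseteq\Sigma''$ is small. $(Opt)$: $\emptyset\subseteq C$ is small. $(iM)$: if $A\subseteq B\subseteq C$ and $B\subseteq C$ is small then $A\subseteq C$ is small. $(<\omega*s)$: if $A,B\subseteq C$ are small then $A\cup B\subseteq C$ is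 small. *)

(* Defs.v *)
From mathcomp Require Import all_boot.
From mathcomp Require Import boolp classical_sets.

Set Implicit Arguments.
Unset Strict Implicit.
Unset Printing Implicit Defensive.

Local Open Scope classical_set_scope.

Section Products.
Variables (X : Type) (F : X -> Type).

(* The full product Pi_X is [forall i, F i]; the partial products are indexed
   by the subtype of the elements of Y. *)
Definition Pi (Y : set X) : Type := forall i : Y, F (\val i).

Definition restr (Y : set X) (s : forall i, F i) : Pi Y := fun i => s (\val i).
Arguments restr Y s : clear implicits.

Definition restrs (Y : set X) (S : set (forall i, F i)) : set (Pi Y) :=
  restr Y @` S.

(* The product of A and B, read as a subset of Pi_X through the identification
   s |-> (s restricted to X', s restricted to X''); see [restr_pair_bij]. *)
Definition prods (X' X'' : set X) (A : set (Pi X')) (B : set (Pi X'')) :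
    set (forall i, F i) :=
  [set s | A (restr X' s) /\ B (restr X'' s)].

Lemma restr_pair_bij (X' X'' : set X) :
  X' `|` X'' = setT -> X' `&` X'' = set0 ->
  bijective (fun s : forall i, F i => (restr X' s, restr X'' s)).
Proof.
move=> XU XI.
have inX'' i : ~ i \in X' -> i \in X''.
  move=> niX'; apply/mem_set.
  have : (X' `|` X'') i by rewrite XU.
  by case=> // /mem_set.
have ninX' i : i \in X'' -> ~ i \in X'.
  move=> /set_mem iX'' /set_mem iX'.
  have : (X' `&` X'') i by [].
  by rewrite XI.
pose glue (p : Pi X' * Pi X'') i : F i :=
  match pselect (i \in X') with
  | left h => p.1 (exist _ i h)
  | right h => p.2 (exist _ i (inX'' i h))
  end.
exists glue => [s | [u v]].
  by apply: functional_extensionality_dep => i; rewrite /glue; case: pselect.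
congr pair; apply: functional_extensionality_dep => -[i h];
  rewrite /restr /glue /=; case: pselect => h'.
- by rewrite (bool_irrelevance h' h).
- by case: (h').
- by case: (ninX' i h).
- by rewrite (bool_irrelevance (inX'' i h') h).
Qed.

End Products.

Arguments restr {X F} Y s.
Arguments restrs {X F} Y S.
Arguments prods {X F X' X''} A B.

(* [big s C A] reads: A is a big subset of C. *)
Record size_notion (T : Type) := SizeNotion {
  big : set T -> set T -> Prop;
  big_subset : forall C A, big C A -> A `<=` C;
  big_refl : forall C, big C C;
  big_mono : forall A B C, A `<=` B -> B `<=` C -> big C A -> big C B
}.

Section Size.
Variables (T : Type) (s : size_notion T).

Definition small (C A : set T) : Prop := A `<=` C /\ big s C (C `\` A).

Definition principal (mu : set T -> set T) : Prop :=
  (forall C, mu C `<=` C) /\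
  (forall C B, big s C B <-> mu C `<=` B /\ B `<=` C).

Definition Opt : Prop := forall C, small C set0.

Definition iM : Prop :=
  forall A B C, A `<=` B -> B `<=` C -> small C B -> small C A.

Definition finite_union_small : Prop :=
  forall A B C, small C A -> small C B -> small C (A `|` B).

End Size.

Section Conditions.
Variables (X : Type) (F : X -> Type) (X' X'' : set X).

Section BigConditions.
Variables (s' : size_notion (Pi F X')) (s'' : size_notion (Pi F X'')).
Variable s : size_notion (forall i, F i).

Definition S_star_1 : Prop :=
  forall Sig' Sig'' Del, Del `<=` prods Sig' Sig'' ->
    (big s (prods Sig' Sig'') Del <->
     exists Gam' Gam'',
       [/\ big s' Sig' Gam', big s'' Sig'' Gam'' & prods Gam' Gam'' `<=` Del]).

Definition S_star_2 : Prop :=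
  (forall Sig Gam, big s Sig Gam -> big s' (restrs X' Sig) (restrs X' Gam)) /\
  (forall Sig Gam, big s Sig Gam -> big s'' (restrs X'' Sig) (restrs X'' Gam)).

Definition S_star_3 : Prop :=
  forall Sig A, big s Sig A ->
    exists B, big s (prods [set: Pi F X'] (restrs X'' Sig)) B /\
              restrs X'' B `<=` restrs X'' A.

Definition s_star_s : Prop :=
  forall Sig' Gam' Sig'' Gam'', Gam' `<=` Sig' -> Gam'' `<=` Sig'' ->
    (small s (prods Sig' Sig'') (prods Gam' Gam'') <->
     small s' Sig' Gam' \/ small s'' Sig'' Gam'').

End BigConditions.

Section MuConditions.
Variables (mu' : set (Pi F X') -> set (Pi F X')).
Variables (mu'' : set (Pi F X'') -> set (Pi F X'')).
Variable mu : set (forall i, F i) -> set (forall i, F i).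

Definition mu_star_1 : Prop :=
  forall Sig' Sig'', mu (prods Sig' Sig'') = prods (mu' Sig') (mu'' Sig'').

Definition mu_star_2 : Prop :=
  (forall Sig Gam, mu Sig `<=` Gam -> mu' (restrs X' Sig) `<=` restrs X' Gam) /\
  (forall Sig Gam, mu Sig `<=` Gam ->
     mu'' (restrs X'' Sig) `<=` restrs X'' Gam).

Definition mu_star_3 : Prop :=
  forall Sig, restrs X'' (mu (prods [set: Pi F X'] (restrs X'' Sig)))
              `<=` restrs X'' (mu Sig).

End MuConditions.
End Conditions.

Arguments S_star_3 {X F} X' X'' s.
Arguments mu_star_3 {X F} X' X'' mu.

(* Main.v *)
Require Import Defs.
From mathcomp Require Import all_boot.
From mathcomp Require Import boolp classical_sets.

Set Implicit Arguments.
Unset Strict Implicit.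
Unset Printing Implicit Defensive.

Local Open Scope classical_set_scope.

(** The identification of [Pi_X] with [Pi_X' * Pi_X''] gives the two facts used
    about [prods]: a product of inhabited sets is inhabited, and a product of
    two singletons is a singleton.

    Part (1) rests on the first fact.  Two boxes [A' * A''] and [Gam' * Gam'']
    are disjoint only if one pair of factors is disjoint.  Hence a big box
    avoiding [Gam' * Gam''] has a factor, say [A'], avoiding [Gam'], and then
    [Sig' \ Gam'] is big because it contains [A'].  Conversely, if
    [Sig' \ Gam'] is big, the box [(Sig' \ Gam') * Sig''] has big factors and
    avoids [Gam' * Gam''].

    In part (2), [mu C] is the least big subset of [C], so it suffices to test
    each condition on bigness at the sets [mu C]; the operations involved
    (products, restrictions) are monotone.

    In part (3), [mu*1] gives [s*s] by parts (1) and (2).  For the converse, a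
    point [x] of [C] lies outside [mu C] exactly when [{x}] is small in [C], so a
    principal filter is known from its small singletons.  Since singletons of
    [Pi_X] are boxes, [s*s] applied to them says that a point lies outside
    [mu (Sig' * Sig'')] exactly when one of its components lies outside
    [mu' Sig'] or [mu'' Sig''], which is [mu*1]. *)

Lemma prodsS (X : Type) (F : X -> Type) (X' X'' : set X)
    (A' B' : set (Pi F X')) (A'' B'' : set (Pi F X'')) :
  A' `<=` B' -> A'' `<=` B'' -> prods A' A'' `<=` prods B' B''.
Proof. by move=> sub' sub'' p [/sub' Bp' /sub'' Bp'']. Qed.

Lemma restrsS (X : Type) (F : X -> Type) (Y : set X)
    (A B : set (forall i, F i)) :
  A `<=` B -> restrs Y A `<=` restrs Y B.
Proof. exact: image_subset. Qed.

Lemma prods_nonempty (X : Type) (F : X -> Type) (X' X'' : set X)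
    (A' : set (Pi F X')) (A'' : set (Pi F X'')) :
  X' `|` X'' = setT -> X' `&` X'' = set0 ->
  A' !=set0 -> A'' !=set0 -> prods A' A'' !=set0.
Proof.
move=> XU XI [u A'u] [v A''v].
have [glue _ glueK] := restr_pair_bij F XU XI.
by exists (glue (u, v)); case: (glueK (u, v)) => eu ev; split; rewrite ?eu ?ev.
Qed.

Lemma prods_set1 (X : Type) (F : X -> Type) (X' X'' : set X)
    (p : forall i, F i) :
  X' `|` X'' = setT -> X' `&` X'' = set0 ->
  prods [set restr X' p] [set restr X'' p] = [set p].
Proof.
move=> XU XI; apply/seteqP; split=> [q [/= e' e'']|q /= ->]; last by split.
by apply: (bij_inj (restr_pair_bij F XU XI)); rewrite e' e''.
Qed.

Lemma principal_big (T : Type) (s : size_notion T) (mu : set T -> set T) C :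
  principal s mu -> big s C (mu C).
Proof. by move=> [muC bigE]; apply/bigE; split=> //; exact: muC. Qed.

Lemma principal_min (T : Type) (s : size_notion T) (mu : set T -> set T) C B :
  principal s mu -> big s C B -> mu C `<=` B.
Proof. by move=> [_ bigE] /bigE[]. Qed.

(** Small singletons determine [mu]; this is how [mu] is recovered from a
    condition on small sets. *)
Lemma principal_small_set1 (T : Type) (s : size_notion T)
    (mu : set T -> set T) C x :
  principal s mu -> C x -> small s C [set x] <-> ~ mu C x.
Proof.
move=> smu Cx; split=> [[_ /(principal_min smu) sub] mux|nmux].
  by have [_ /=] := sub x mux; apply.
split=> [_ -> //|]; apply: big_mono (principal_big C smu); last exact: subDsetl.
by move=> y muy; split=> [|/= yx]; [exact: smu.1 C y muy|apply: nmux; rewrite -yx].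
Qed.

(** The complement of [Gam] is big, being a superset of the big set [A]. *)
Lemma small_disjoint_big (T : Type) (s : size_notion T) (C A Gam : set T) :
  Gam `<=` C -> big s C A -> ~ (A `&` Gam !=set0) -> small s C Gam.
Proof.
move=> GamC bigA disj; split=> //.
apply: (big_mono _ _ bigA); last exact: subDsetl.
move=> x Ax; split; first exact: big_subset bigA x Ax.
by move=> Gamx; apply: disj; exists x.
Qed.

Lemma S_star_1_s_star_s (X : Type) (F : X -> Type) (X' X'' : set X)
    (s' : size_notion (Pi F X')) (s'' : size_notion (Pi F X''))
    (s : size_notion (forall i, F i)) :
  X' `|` X'' = setT -> X' `&` X'' = set0 ->
  S_star_1 s' s'' s -> s_star_s s' s'' s.
Proof.
move=> XU XI S1 Sig' Gam' Sig'' Gam'' sub' sub''.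
have bigP := S1 Sig' Sig'' _ (@subDsetl _ _ (prods Gam' Gam'')).
split=> [[_ /bigP[A' [A'' [big' big'' subA]]]]|smallG].
  have [meet'|] := pselect (A' `&` Gam' !=set0); last first.
    by move=> disj; left; apply: small_disjoint_big big' disj.
  right; apply: small_disjoint_big big'' _ => // meet''.
  have [p [[A'p G'p] [A''p G''p]]] := prods_nonempty XU XI meet' meet''.
  by have [_] := subA p (conj A'p A''p); apply.
split; first exact: prodsS.
apply/bigP; case: smallG => [[_ bigD]|[_ bigD]].
- exists (Sig' `\` Gam'), Sig''; split=> //; first exact: big_refl.
  by move=> p [[Sp' nGp'] Sp'']; split=> // -[/nGp'].
- exists Sig', (Sig'' `\` Gam''); split=> //; first exact: big_refl.
  by move=> p [Sp' [Sp'' nGp'']]; split=> // -[_ /nGp''].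
Qed.

Lemma S_star_1_mu (X : Type) (F : X -> Type) (X' X'' : set X)
    (s' : size_notion (Pi F X')) (s'' : size_notion (Pi F X''))
    (s : size_notion (forall i, F i)) mu' mu'' mu :
  principal s' mu' -> principal s'' mu'' -> principal s mu ->
  S_star_1 s' s'' s <-> mu_star_1 mu' mu'' mu.
Proof.
move=> smu' smu'' smu; split=> [S1 Sig' Sig''|mu1 Sig' Sig'' Del subDel].
  apply/seteqP; split.
    apply: (principal_min smu).
    apply/S1; first by apply: prodsS; [exact: smu'.1|exact: smu''.1].
    by exists (mu' Sig'), (mu'' Sig''); split=> //; exact: principal_big.
  have [A' [A'' [big' big'' subA]]] :=
    (S1 _ _ _ (smu.1 _)).1 (principal_big (prods Sig' Sig'') smu).
  apply: subset_trans subA.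
  by apply: prodsS; [exact: principal_min big'|exact: principal_min big''].
split=> [/(principal_min smu)|[A' [A'' [big' big'' subA]]]].
  rewrite mu1 => subD; exists (mu' Sig'), (mu'' Sig'').
  by split=> //; exact: principal_big.
apply/smu.2; split=> //; rewrite mu1; apply: subset_trans subA.
by apply: prodsS; [exact: principal_min big'|exact: principal_min big''].
Qed.

(** A big [Gam] lies in [Sig], whereas on the [mu] side [Gam] may leave [Sig];
    passing through [Gam = mu Sig] bridges the difference. *)
Lemma restrs_big_mu (X : Type) (F : X -> Type) (Y : set X)
    (t : size_notion (Pi F Y)) (s : size_notion (forall i, F i)) nu mu :
  principal t nu -> principal s mu ->
  (forall Sig Gam, big s Sig Gam -> big t (restrs Y Sig) (restrs Y Gam)) <->
  (forall Sig Gam, mu Sig `<=` Gam -> nu (restrs Y Sig) `<=` restrs Y Gam).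
Proof.
move=> tnu smu; split=> [S2 Sig Gam subG|mu2 Sig Gam bigG].
  apply: subset_trans (restrsS subG).
  exact: principal_min tnu (S2 _ _ (principal_big Sig smu)).
apply/tnu.2; split; first by apply: mu2; exact: principal_min bigG.
by apply: restrsS; exact: big_subset bigG.
Qed.

Lemma S_star_2_mu (X : Type) (F : X -> Type) (X' X'' : set X)
    (s' : size_notion (Pi F X')) (s'' : size_notion (Pi F X''))
    (s : size_notion (forall i, F i)) mu' mu'' mu :
  principal s' mu' -> principal s'' mu'' -> principal s mu ->
  S_star_2 s' s'' s <-> mu_star_2 mu' mu'' mu.
Proof.
move=> smu' smu'' smu; rewrite /S_star_2 /mu_star_2.
have := restrs_big_mu smu' smu; have := restrs_big_mu smu'' smu; tauto.
Qed.

Lemma S_star_3_mu (X : Type) (F : X -> Type) (X' X'' : set X)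
    (s : size_notion (forall i, F i)) mu :
  principal s mu -> S_star_3 X' X'' s <-> mu_star_3 X' X'' mu.
Proof.
move=> smu; split=> [S3 Sig|mu3 Sig A bigA].
  have [B [bigB subB]] := S3 _ _ (principal_big Sig smu).
  by apply: subset_trans subB; apply: restrsS; exact: principal_min bigB.
exists (mu (prods [set: Pi F X'] (restrs X'' Sig))).
split; first exact: principal_big.
apply: subset_trans (mu3 Sig) _; apply: restrsS.
exact: principal_min bigA.
Qed.

(** Singletons of [Pi_X] are boxes, so [s*s] describes the small singletons of
    [Sig' * Sig''], and with them [mu (Sig' * Sig'')]. *)
Lemma s_star_s_mu_star_1 (X : Type) (F : X -> Type) (X' X'' : set X)
    (s' : size_notion (Pi F X')) (s'' : size_notion (Pi F X''))
    (s : size_notion (forall i, F i)) mu' mu'' mu :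
  X' `|` X'' = setT -> X' `&` X'' = set0 ->
  principal s' mu' -> principal s'' mu'' -> principal s mu ->
  s_star_s s' s'' s -> mu_star_1 mu' mu'' mu.
Proof.
move=> XU XI smu' smu'' smu ss Sig' Sig''.
have muE p : prods Sig' Sig'' p ->
    ~ mu (prods Sig' Sig'') p <->
    ~ mu' Sig' (restr X' p) \/ ~ mu'' Sig'' (restr X'' p).
  move=> Sp; case: (Sp) => Sp' Sp''.
  have := ss Sig' [set restr X' p] Sig'' [set restr X'' p].
  rewrite prods_set1 // (principal_small_set1 smu Sp).
  rewrite (principal_small_set1 smu' Sp') (principal_small_set1 smu'' Sp'').
  by apply=> _ ->.
apply/seteqP; split=> p.
  move=> mup; have := muE p (smu.1 _ _ mup).
  by split; apply: contrapT; tauto.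
move=> [mup' mup'']; apply: contrapT.
have := muE p (conj (smu'.1 _ _ mup') (smu''.1 _ _ mup'')); tauto.
Qed.

Theorem proposition5p2p1 (X : Type) (F : X -> Type) (X' X'' : set X)
  (XU : X' `|` X'' = setT) (XI : X' `&` X'' = set0)
  (s' : size_notion (Pi F X')) (s'' : size_notion (Pi F X''))
  (s : size_notion (forall i, F i)) :
  (S_star_1 s' s'' s ->
   forall (Sig' Gam' : set (Pi F X')) (Sig'' Gam'' : set (Pi F X'')),
     Gam' `<=` Sig' -> Gam'' `<=` Sig'' ->
     (small s (prods Sig' Sig'') (prods Gam' Gam'') <->
      small s' Sig' Gam' \/ small s'' Sig'' Gam'')) /\
  (forall (mu' : set (Pi F X') -> set (Pi F X'))
          (mu'' : set (Pi F X'') -> set (Pi F X''))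
          (mu : set (forall i, F i) -> set (forall i, F i)),
     principal s' mu' -> principal s'' mu'' -> principal s mu ->
     [/\ S_star_1 s' s'' s <-> mu_star_1 mu' mu'' mu,
         S_star_2 s' s'' s <-> mu_star_2 mu' mu'' mu &
         S_star_3 X' X'' s <-> mu_star_3 X' X'' mu]) /\
  (forall (mu' : set (Pi F X') -> set (Pi F X'))
          (mu'' : set (Pi F X'') -> set (Pi F X''))
          (mu : set (forall i, F i) -> set (forall i, F i)),
     principal s' mu' -> principal s'' mu'' -> principal s mu ->
     [/\ Opt s', Opt s'' & Opt s] ->
     [/\ iM s', iM s'' & iM s] ->
     [/\ finite_union_small s', finite_union_small s'' &
         finite_union_small s] ->
     (mu_star_1 mu' mu'' mu <-> s_star_s s' s'' s)).
Proof.
split; first exact: S_star_1_s_star_s.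
split=> mu' mu'' mu smu' smu'' smu.
  by split; [exact: S_star_1_mu|exact: S_star_2_mu|exact: S_star_3_mu].
move=> _ _ _; split; last exact: s_star_s_mu_star_1.
by move/(S_star_1_mu smu' smu'' smu); exact: S_star_1_s_star_s.
Qed.
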